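(* Let $A$ be a commutative ring and let $\mathfrak j_1$ and $\mathfrak j_2$ be two finitely generated ideals of $A$. The elements $D_A(\mathfrak j_1)$ and $D_A(\mathfrak j_2)$ of $\mathrm{Zar}(A)$ are equal in the quotient lattice $\mathrm{Heit}(A)$ if and only if $J_A(\mathfrak j_1)=J_A(\mathfrak j_2)$. Hence $\mathrm{Heit}(A)$ may be identified with the set of the ideals $J_A(x_1,\ldots,x_n)$ (with $n\in\mathbb N$, $x_1,\dots,x_n\in A$), with lattice operations given, for finitely generated ideals $\mathfrak j_1,\mathfrak j_2$ of $A$, by $$J_A(\mathfrak j_1)\wedge J_A(\mathfrak j_2)=J_A(\mathfrak j_1\mathfrak j_2),\qquad J_A(\mathfrak j_1)\vee J_A(\mathfrak j_2)=J_A(\mathfrak j_1+\mathfrak j_2).$$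
   Context: For an ideal $\mathfrak a$ of the commutative ring $A$, $D_A(\mathfrak a)=\sqrt{\mathfrak a}$ is its nilradical. The Zariski lattice $\mathrm{Zar}(A)$ is the set of the $D_A(\mathfrak a)$ for $\mathfrak a$ a finitely generated ideal of $A$, ordered by inclusion; it is a distributive lattice with $D_A(\mathfrak a_1)\wedge D_A(\mathfrak a_2)=D_A(\mathfrak a_1\mathfrak a_2)$ and $D_A(\mathfrak a_1)\vee D_A(\mathfrak a_2)=D_A(\mathfrak a_1+\mathfrak a_2)$. The Jacobson radical of an ideal $\mathfrak J$ of $A$ is $J_A(\mathfrak J)=\{x\in A:\forall y\in A,\ 1+xy\text{ is invertible modulo }\mathfrak J\}$ (classically, the intersection of the maximal ideals containing $\mathfrak J$), and $J_A(x_1,\ldots,x_n)=J_A(\langle x_1,\ldots,x_n\rangle)$. For a distributive lattice $T$ (with $0$ and $1$) and $b\in T$, $J_T(b)=\{a\in T:\forall x\in T\ (a\vee x=1\Rightarrow b\vee x=1)\}$. The Heitmann lattice $\mathrm{He}(T)$ is the quotient lattice of $T$ by the preorder $a\preceq b$ iff $J_T(a)\subseteq J_T(b)$ (equivalently $a\in J_T(b)$). One defines $\mathrm{Heit}(A)=\mathrm{He}(\mathrm{Zar}(A))$. *)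

(* Defs.v *)
From HB Require Import structures.
From mathcomp Require Import all_boot all_order all_algebra ring.
From mathcomp Require Import generic_quotient boolp classical_sets.

Set Implicit Arguments.
Unset Strict Implicit.
Unset Printing Implicit Defensive.

Import Order.TTheory GRing.Theory.

Local Open Scope classical_set_scope.
Local Open Scope ring_scope.
Local Open Scope quotient_scope.

(* Rings may be trivial.  The ideals of ring_quotient are proper ideals, given
   by boolean predicates; here ideals are arbitrary sets and may contain 1. *)
Section Ideals.
Context {A : comPzRingType}.
Implicit Types (I J K : set A).

Record is_ideal I : Prop := IsIdeal {
  ideal0 : I 0;
  idealD : forall a b, I a -> I b -> I (a + b);
  idealMl : forall c a, I a -> I (c * a)
}.

Definition idgen n (x : 'I_n -> A) : set A :=
  [set a | exists c : 'I_n -> A, a = \sum_(i < n) c i * x i].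

Definition fg_ideal I : Prop := exists n (x : 'I_n -> A), I = idgen x.

Definition idadd I J : set A := [set a + b | a in I & b in J].

(* Finite sums of products of an element of I and an element of J. *)
Definition idmul I J : set A :=
  [set a | exists n (x y : 'I_n -> A),
     [/\ forall i, I (x i), forall i, J (y i) & a = \sum_(i < n) x i * y i]].

Definition nilrad I : set A := [set a | exists k : nat, I (a ^+ k)].

(* 1 + x y is invertible modulo I: some z satisfies (1 + x y) z = 1 mod I. *)
Definition jac I : set A :=
  [set x | forall y, exists z, I ((1 + x * y) * z - 1)].

Lemma ideal_sum I n (f : 'I_n -> A) :
  is_ideal I -> (forall i, I (f i)) -> I (\sum_(i < n) f i).
Proof.
move=> hI hf; elim/big_ind: _ => //; [exact: ideal0 | exact: idealD].
Qed.

Lemma idealMr I c a : is_ideal I -> I a -> I (a * c).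
Proof. by move=> hI Ia; rewrite mulrC; apply: idealMl. Qed.

Lemma idealN I a : is_ideal I -> I a -> I (- a).
Proof. by move=> hI Ia; rewrite -mulN1r; apply: idealMl. Qed.

Lemma idgen_ideal n (x : 'I_n -> A) : is_ideal (idgen x).
Proof.
split.
- by exists (fun=> 0); rewrite big1// => i _; rewrite mul0r.
- move=> _ _ [c ->] [d ->]; exists (fun i => c i + d i).
  by rewrite -big_split; apply: eq_bigr => i _; rewrite mulrDl.
- move=> e _ [c ->]; exists (fun i => e * c i).
  by rewrite mulr_sumr; apply: eq_bigr => i _; rewrite mulrA.
Qed.

Lemma idgen_gen n (x : 'I_n -> A) i : idgen x (x i).
Proof.
exists (fun j => (j == i)%:R); rewrite (bigD1 i)//= eqxx mul1r big1 ?addr0//.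
by move=> j /negPf ->; rewrite mul0r.
Qed.

Lemma idgen_min n (x : 'I_n -> A) I :
  is_ideal I -> (forall i, I (x i)) -> idgen x `<=` I.
Proof.
by move=> hI hx _ [c ->]; apply: ideal_sum => // i; apply: idealMl.
Qed.

Lemma fg_ideal_ideal I : fg_ideal I -> is_ideal I.
Proof. by move=> [n [x ->]]; exact: idgen_ideal. Qed.

Lemma idadd_ideal I J : is_ideal I -> is_ideal J -> is_ideal (idadd I J).
Proof.
move=> hI hJ; split.
- by exists 0; [exact: ideal0|exists 0; [exact: ideal0|rewrite addr0]].
- move=> _ _ [a Ia [b Jb <-]] [c Ic [d Jd <-]].
  exists (a + c); first exact: idealD.
  by exists (b + d); [exact: idealD|ring].
- move=> e _ [a Ia [b Jb <-]]; exists (e * a); first exact: idealMl.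
  by exists (e * b); [exact: idealMl|ring].
Qed.

Lemma idadd_min I J K :
  is_ideal K -> I `<=` K -> J `<=` K -> idadd I J `<=` K.
Proof.
by move=> hK IK JK _ [a Ia [b Jb <-]]; apply: idealD => //; [exact: IK|exact: JK].
Qed.

Lemma idadd_l I J : is_ideal J -> I `<=` idadd I J.
Proof. by move=> hJ a Ia; exists a => //; exists 0; [exact: ideal0|rewrite addr0]. Qed.

Lemma idadd_r I J : is_ideal I -> J `<=` idadd I J.
Proof. by move=> hI a Ja; exists 0; [exact: ideal0|exists a => //; rewrite add0r]. Qed.

Lemma idmul_ideal I J : is_ideal I -> is_ideal (idmul I J).
Proof.
move=> hI; split.
- by exists 0%N, (fun=> 0), (fun=> 0); rewrite big_ord0; split => // -[].
- move=> _ _ [n [x [y [Ix Jy ->]]]] [m [u [v [Iu Jv ->]]]].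
  pose g (w : 'I_n -> A) (w' : 'I_m -> A) (i : 'I_(n + m)) :=
    match split i with inl j => w j | inr j => w' j end.
  exists (n + m)%N, (g x u), (g y v); split.
  + by move=> i; rewrite /g; case: split.
  + by move=> i; rewrite /g; case: split.
  + rewrite big_split_ord /=; congr (_ + _); apply: eq_bigr => i _;
      by rewrite /g ?(unsplitK (inl i)) ?(unsplitK (inr i)).
- move=> e _ [n [x [y [Ix Jy ->]]]]; exists n, (fun i => e * x i), y.
  split=> // [i|]; first exact: idealMl.
  by rewrite mulr_sumr; apply: eq_bigr => i _; rewrite mulrA.
Qed.

Lemma idmul_mem I J a b : I a -> J b -> idmul I J (a * b).
Proof.
move=> Ia Jb; exists 1%N, (fun=> a), (fun=> b).
by split=> //; rewrite big_ord_recl big_ord0 addr0.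
Qed.

Lemma idmul_min I J K : is_ideal K ->
  (forall a b, I a -> J b -> K (a * b)) -> idmul I J `<=` K.
Proof.
by move=> hK h _ [n [x [y [Ix Jy ->]]]]; apply: ideal_sum => // i; apply: h.
Qed.

Lemma idgen_add n m (x : 'I_n -> A) (y : 'I_m -> A) :
  idadd (idgen x) (idgen y) =
  idgen (fun i : 'I_(n + m) => match split i with inl j => x j | inr j => y j end).
Proof.
apply/seteqP; split.
- apply: idadd_min; first exact: idgen_ideal.
  + apply: idgen_min => [|i]; first exact: idgen_ideal.
    have := idgen_gen (fun i : 'I_(n + m) =>
      match split i with inl j => x j | inr j => y j end) (lshift m i).
    by rewrite (unsplitK (inl i)).
  + apply: idgen_min => [|i]; first exact: idgen_ideal.
    have := idgen_gen (fun i : 'I_(n + m) =>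
      match split i with inl j => x j | inr j => y j end) (rshift n i).
    by rewrite (unsplitK (inr i)).
- apply: idgen_min => [|i]; first by apply: idadd_ideal; exact: idgen_ideal.
  case: split => j; [apply: idadd_l|apply: idadd_r];
    by [exact: idgen_ideal|exact: idgen_gen].
Qed.

Lemma idgen_mul n m (x : 'I_n -> A) (y : 'I_m -> A) :
  idmul (idgen x) (idgen y) =
  idgen (fun i : 'I_#|{: 'I_n * 'I_m}| => x (enum_val i).1 * y (enum_val i).2).
Proof.
apply/seteqP; split.
- apply: idmul_min; first exact: idgen_ideal.
  move=> _ _ [c ->] [d ->]; rewrite mulr_suml.
  apply: ideal_sum => [|i]; first exact: idgen_ideal.
  rewrite mulr_sumr; apply: ideal_sum => [|j]; first exact: idgen_ideal.
  rewrite mulrACA; apply: idealMl; first exact: idgen_ideal.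
  have := idgen_gen (fun i : 'I_#|{: 'I_n * 'I_m}| =>
    x (enum_val i).1 * y (enum_val i).2) (enum_rank (i, j)).
  by rewrite enum_rankK.
- apply: idgen_min => [|i]; first by apply: idmul_ideal; exact: idgen_ideal.
  by apply: idmul_mem; exact: idgen_gen.
Qed.

Lemma fg_idadd I J : fg_ideal I -> fg_ideal J -> fg_ideal (idadd I J).
Proof.
by move=> [n [x ->]] [m [y ->]]; rewrite idgen_add; eexists; eexists; reflexivity.
Qed.

Lemma fg_idmul I J : fg_ideal I -> fg_ideal J -> fg_ideal (idmul I J).
Proof.
by move=> [n [x ->]] [m [y ->]]; rewrite idgen_mul; eexists; eexists; reflexivity.
Qed.

Lemma idealX I a k l : is_ideal I -> (k <= l)%N -> I (a ^+ k) -> I (a ^+ l).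
Proof. by move=> hI /subnK <- Ia; rewrite exprD; apply: idealMl. Qed.

Lemma nilrad_ideal I : is_ideal I -> is_ideal (nilrad I).
Proof.
move=> hI; split.
- by exists 1%N; rewrite expr1; exact: ideal0.
- move=> a b [k Ia] [l Ib]; exists (k + l)%N; rewrite exprDn.
  apply: ideal_sum => // i; rewrite -mulr_natr; apply: idealMr => //.
  have [li|il] := leqP l i; first by apply: idealMl => //; exact: idealX li Ib.
  by apply: idealMr => //; apply: (@idealX _ _ k) => //; rewrite -addnBA ?leq_addr// ltnW.
- by move=> c a [k Ia]; exists k; rewrite exprMn; apply: idealMl.
Qed.

Lemma sub_nilrad I : I `<=` nilrad I.
Proof. by move=> a Ia; exists 1%N; rewrite expr1. Qed.

Lemma nilradS I J : I `<=` J -> nilrad I `<=` nilrad J.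
Proof. by move=> IJ a [k Ia]; exists k; exact: IJ. Qed.

Lemma nilradK I : nilrad (nilrad I) = nilrad I.
Proof.
apply/seteqP; split; last exact: sub_nilrad.
by move=> a [k [l Ia]]; exists (k * l)%N; rewrite exprM.
Qed.

Lemma nilrad_min I J : I `<=` nilrad J -> nilrad I `<=` nilrad J.
Proof. by rewrite -{2}[nilrad J]nilradK; exact: nilradS. Qed.

Lemma nilrad_idmul I J : is_ideal I -> is_ideal J ->
  nilrad (idmul I J) = nilrad I `&` nilrad J.
Proof.
move=> hI hJ; apply/seteqP; split.
- by move=> a ha; split; move: a ha; apply: nilradS; apply: idmul_min => // a b Ia Jb;
    [apply: idealMr|apply: idealMl].
- by move=> a [[k Ia] [l Ja]]; exists (k + l)%N; rewrite exprD; apply: idmul_mem.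
Qed.

Lemma nilrad_idaddK I J : is_ideal I -> is_ideal J ->
  nilrad (idadd (nilrad I) (nilrad J)) = nilrad (idadd I J).
Proof.
move=> hI hJ; apply/seteqP; split.
- apply: nilrad_min; apply: idadd_min.
  + by apply: nilrad_ideal; exact: idadd_ideal.
  + by apply: nilradS; exact: idadd_l.
  + by apply: nilradS; exact: idadd_r.
- apply: nilradS => _ [a Ia [b Jb <-]].
  by exists a; [exact: sub_nilrad|exists b; [exact: sub_nilrad|]].
Qed.

Lemma nilrad_idmulK I J : is_ideal I -> is_ideal J ->
  nilrad (idmul (nilrad I) (nilrad J)) = nilrad (idmul I J).
Proof.
move=> hI hJ; rewrite !nilrad_idmul ?nilradK//; exact: nilrad_ideal.
Qed.

Lemma jac_ideal I : is_ideal I -> is_ideal (jac I).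
Proof.
move=> hI; split.
- by move=> y; exists 1; rewrite mul0r addr0 mulr1 subrr; exact: ideal0.
- move=> a b Ja Jb y; have [z hz] := Ja y; have [w hw] := Jb (y * z).
  exists (z * w).
  have -> : (1 + (a + b) * y) * (z * w) - 1 =
    w * ((1 + a * y) * z - 1) + ((1 + b * (y * z)) * w - 1) by ring.
  by apply: idealD => //; exact: idealMl.
- by move=> c a Ja y; have [z hz] := Ja (c * y); exists z; rewrite (mulrC c) -mulrA.
Qed.

End Ideals.

Record fgIdeal (A : comPzRingType) := FgIdeal {
  fgideal_set :> set A;
  fgideal_fg : fg_ideal fgideal_set
}.

Section FgIdeals.
Context {A : comPzRingType}.
Implicit Types (a b : fgIdeal A).

Definition fggen n (x : 'I_n -> A) : fgIdeal A :=
  FgIdeal (ex_intro _ n (ex_intro _ x erefl)).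

Definition fgadd a b : fgIdeal A :=
  FgIdeal (fg_idadd (fgideal_fg a) (fgideal_fg b)).

Definition fgmul a b : fgIdeal A :=
  FgIdeal (fg_idmul (fgideal_fg a) (fgideal_fg b)).

Lemma fgideal_ideal a : is_ideal a.
Proof. exact: fg_ideal_ideal (fgideal_fg a). Qed.

End FgIdeals.

Record Zar (A : comPzRingType) := MkZar {
  zar_set :> set A;
  _ : `[< exists a : fgIdeal A, zar_set = nilrad a >]
}.

HB.instance Definition _ A := [isSub for @zar_set A].
HB.instance Definition _ A := [Choice of Zar A by <:].

Fact zar_display : Order.disp_t. Proof. exact: (Order.Disp tt tt). Qed.

Section ZariskiLattice.
Context {A : comPzRingType}.
Implicit Types (a b : fgIdeal A) (s t u : Zar A).

Fact zarD_subproof a :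
  `[< exists a' : fgIdeal A, nilrad a = nilrad a' >].
Proof. by apply/asboolP; exists a. Qed.

Definition zarD a : Zar A := MkZar (zarD_subproof a).

Lemma zarP s : exists a, s = zarD a.
Proof. by case: s => S hS; have /asboolP[a Sa] := hS; exists a; apply: val_inj. Qed.

Definition zar_le s t : bool := `[< (s : set A) `<=` t >].

Fact zar_le_refl : reflexive zar_le.
Proof. by move=> s; apply/asboolP. Qed.

Fact zar_le_anti : antisymmetric zar_le.
Proof.
by move=> s t /andP[/asboolP st /asboolP ts]; apply/val_inj/seteqP.
Qed.

Fact zar_le_trans : transitive zar_le.
Proof.
by move=> t s u /asboolP st /asboolP tu; apply/asboolP; exact: subset_trans tu.
Qed.

HB.instance Definition _ := Order.Le_isPOrder.Build zar_display (Zar A)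
  zar_le_refl zar_le_anti zar_le_trans.

Fact zar_meet_subproof s t :
  `[< exists a : fgIdeal A, nilrad (idmul s t) = nilrad a >].
Proof.
have [a ->] := zarP s; have [b ->] := zarP t; apply/asboolP; exists (fgmul a b).
by apply: nilrad_idmulK; exact: fgideal_ideal.
Qed.

Fact zar_join_subproof s t :
  `[< exists a : fgIdeal A, nilrad (idadd s t) = nilrad a >].
Proof.
have [a ->] := zarP s; have [b ->] := zarP t; apply/asboolP; exists (fgadd a b).
by apply: nilrad_idaddK; exact: fgideal_ideal.
Qed.

(* Computed on the radical ideals s and t themselves; zarI and zarU below give
   the formulas in terms of finitely generated ideals. *)
Definition zar_meet s t : Zar A := MkZar (zar_meet_subproof s t).
Definition zar_join s t : Zar A := MkZar (zar_join_subproof s t).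

Lemma zar_meetD a b : zar_meet (zarD a) (zarD b) = zarD (fgmul a b).
Proof. by apply: val_inj; apply: nilrad_idmulK; exact: fgideal_ideal. Qed.

Lemma zar_joinD a b : zar_join (zarD a) (zarD b) = zarD (fgadd a b).
Proof. by apply: val_inj; apply: nilrad_idaddK; exact: fgideal_ideal. Qed.

Lemma zar_ideal s : is_ideal s.
Proof. by have [a ->] := zarP s; exact/nilrad_ideal/fgideal_ideal. Qed.

Lemma zar_nilrad s : nilrad s = s.
Proof. by have [a ->] := zarP s; exact: nilradK. Qed.

Fact zar_lexI s t u : (s <= zar_meet t u)%O = (s <= t)%O && (s <= u)%O.
Proof.
have E : (zar_meet t u : set A) = (t : set A) `&` u.
  by rewrite /= nilrad_idmul ?zar_nilrad//; exact: zar_ideal.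
apply/asboolP/andP; rewrite E.
- by move=> h; split; apply/asboolP => x /h[].
- by move=> [/asboolP st /asboolP su] x sx; split; [exact: st|exact: su].
Qed.

Fact zar_leUx s t u : (zar_join s t <= u)%O = (s <= u)%O && (t <= u)%O.
Proof.
apply/asboolP/andP => /=.
- move=> h; split; apply/asboolP => x hx; apply: h; apply: sub_nilrad.
  + exact: idadd_l (zar_ideal t) _ hx.
  + exact: idadd_r (zar_ideal s) _ hx.
- move=> [/asboolP su /asboolP tu]; rewrite -[X in _ `<=` X]zar_nilrad.
  by apply: nilradS; apply: idadd_min => //; exact: zar_ideal.
Qed.

HB.instance Definition _ :=
  Order.POrder_isMeetSemilattice.Build zar_display (Zar A) zar_lexI.
HB.instance Definition _ :=
  Order.POrder_isJoinSemilattice.Build zar_display (Zar A) zar_leUx.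

Lemma zarI a b : Order.meet (zarD a) (zarD b) = zarD (fgmul a b).
Proof. exact: zar_meetD. Qed.

Lemma zarU a b : Order.join (zarD a) (zarD b) = zarD (fgadd a b).
Proof. exact: zar_joinD. Qed.

Fact zar_meetUl : left_distributive (@Order.meet _ (Zar A)) Order.join.
Proof.
move=> s t u; have [a ->] := zarP s; have [b ->] := zarP t.
have [c ->] := zarP u.
change (zar_meet (zar_join (zarD a) (zarD b)) (zarD c) =
  zar_join (zar_meet (zarD a) (zarD c)) (zar_meet (zarD b) (zarD c))).
rewrite zar_joinD !zar_meetD zar_joinD; apply: val_inj => /=.
congr nilrad; have ha := fgideal_ideal a; have hb := fgideal_ideal b.
have hc := fgideal_ideal c.
have hac : is_ideal (idmul a c) by exact: idmul_ideal.
have hbc : is_ideal (idmul b c) by exact: idmul_ideal.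
have hab : is_ideal (idadd a b) by exact: idadd_ideal.
apply/seteqP; split.
- apply: idmul_min; first exact: idadd_ideal.
  move=> _ z [x ax [y by_ <-]] cz; exists (x * z); first exact: idmul_mem.
  by exists (y * z); [exact: idmul_mem|rewrite mulrDl].
- apply: idadd_min; first exact: idmul_ideal.
  + apply: idmul_min => [|x z ax cz]; first exact: idmul_ideal.
    by apply: idmul_mem => //; exact: idadd_l hb _ ax.
  + apply: idmul_min => [|x z bx cz]; first exact: idmul_ideal.
    by apply: idmul_mem => //; exact: idadd_r ha _ bx.
Qed.

HB.instance Definition _ :=
  Order.Lattice_Meet_isDistrLattice.Build zar_display (Zar A) zar_meetUl.

Fact zar_le0x s : (zarD (fggen (fun _ : 'I_0 => 0)) <= s)%O.
Proof.
apply/asboolP => /=; rewrite -[X in _ `<=` X]zar_nilrad; apply: nilradS.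
by apply: idgen_min => [|[]//]; exact: zar_ideal.
Qed.

Fact zar_lex1 s : (s <= zarD (fggen (fun _ : 'I_1 => 1)))%O.
Proof.
apply/asboolP => x _; apply: sub_nilrad; exists (fun=> x).
by rewrite big_ord_recl big_ord0 addr0 mulr1.
Qed.

HB.instance Definition _ := Order.hasBottom.Build zar_display (Zar A) zar_le0x.
HB.instance Definition _ := Order.hasTop.Build zar_display (Zar A) zar_lex1.

End ZariskiLattice.

Section HeitmannLattice.
Context {d : Order.disp_t} (T : tbDistrLatticeType d).
Implicit Types (a b c x : T).
Local Open Scope order_scope.

Definition latJac b : set T :=
  [set a | forall x, Order.join a x = \top -> Order.join b x = \top].

Definition he_le a b : bool := `[< (latJac a `<=` latJac b)%classic >].

Lemma he_leP a b : reflect (latJac b a) (he_le a b).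
Proof.
apply: (iffP idP) => [/asboolP|ba]; first by apply.
by apply/asboolP => c ca x /ca/ba.
Qed.

Definition he_eq a b : bool := he_le a b && he_le b a.

Fact he_le_refl : reflexive he_le.
Proof. by move=> a; apply/asboolP. Qed.

Fact he_le_trans : transitive he_le.
Proof.
by move=> b a c /asboolP ab /asboolP bc; apply/asboolP; exact: subset_trans bc.
Qed.

Fact he_eq_refl : reflexive he_eq.
Proof. by move=> a; rewrite /he_eq he_le_refl. Qed.

Fact he_eq_sym : symmetric he_eq.
Proof. by move=> a b; rewrite /he_eq andbC. Qed.

Fact he_eq_trans : transitive he_eq.
Proof.
move=> b a c /andP[ab ba] /andP[bc cb]; apply/andP; split.
- exact: he_le_trans ab bc.
- exact: he_le_trans cb ba.
Qed.

Canonical he_equiv := EquivRel he_eq he_eq_refl he_eq_sym he_eq_trans.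

Definition He := {eq_quot he_equiv}.

HB.instance Definition _ := Choice.on He.
HB.instance Definition _ := EqQuotient.on He.

(* Induced structure on classes, read on representatives; he_le_pi, he_meet_pi
   and he_join_pi below show that it does not depend on them. *)
Definition heq_le (p q : He) : bool := he_le (repr p) (repr q).
Definition heq_meet (p q : He) : He := \pi_He (Order.meet (repr p) (repr q)).
Definition heq_join (p q : He) : He := \pi_He (Order.join (repr p) (repr q)).

Lemma he_piP a b : \pi_He a = \pi_He b <-> he_eq a b.
Proof. by split => [/eqmodP|h]; last exact/eqmodP. Qed.

Lemma he_repr a : he_eq (repr (\pi_He a)) a.
Proof. by apply/he_piP; rewrite reprK. Qed.

Lemma heq_le_pi a b : heq_le (\pi_He a) (\pi_He b) = he_le a b.
Proof.
rewrite /heq_le; have /andP[a1 a2] := he_repr a; have /andP[b1 b2] := he_repr b.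
apply/idP/idP => h.
- exact: he_le_trans a2 (he_le_trans h b1).
- exact: he_le_trans a1 (he_le_trans h b2).
Qed.

Lemma he_lexI a b c : he_le a (Order.meet b c) = he_le a b && he_le a c.
Proof.
apply/he_leP/andP.
- move=> h; split; apply/he_leP => x /h /eqP; rewrite joinIl;
    by rewrite -le1x lexI !le1x => /andP[/eqP ? /eqP ?].
- by move=> [/he_leP ab /he_leP ac] x h; rewrite joinIl ab// ac// meetxx.
Qed.

Lemma he_leUx a b c : he_le (Order.join a b) c = he_le a c && he_le b c.
Proof.
apply/he_leP/andP.
- move=> h; split; apply/he_leP => x /eqP ax; apply: h; apply/eqP; move: ax;
    by rewrite -!le1x => /le_trans; apply; rewrite leU2// ?leUl ?leUr.
- move=> [/he_leP ac /he_leP bc] x; rewrite -joinA => /ac.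
  by rewrite joinCA => /bc; rewrite joinA joinxx.
Qed.

Lemma heq_meet_pi a b : heq_meet (\pi_He a) (\pi_He b) = \pi_He (Order.meet a b).
Proof.
have /andP[a1 a2] := he_repr a; have /andP[b1 b2] := he_repr b.
have L (u v : T) : he_le (Order.meet u v) u.
  by move: (he_le_refl (Order.meet u v)); rewrite he_lexI => /andP[].
have R (u v : T) : he_le (Order.meet u v) v.
  by move: (he_le_refl (Order.meet u v)); rewrite he_lexI => /andP[].
apply/he_piP/andP; split; rewrite he_lexI; apply/andP; split;
  solve [apply: he_le_trans (L _ _) _; assumption
       | apply: he_le_trans (R _ _) _; assumption].
Qed.

Lemma heq_join_pi a b : heq_join (\pi_He a) (\pi_He b) = \pi_He (Order.join a b).
Proof.
have /andP[a1 a2] := he_repr a; have /andP[b1 b2] := he_repr b.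
have L (u v : T) : he_le u (Order.join u v).
  by move: (he_le_refl (Order.join u v)); rewrite he_leUx => /andP[].
have R (u v : T) : he_le v (Order.join u v).
  by move: (he_le_refl (Order.join u v)); rewrite he_leUx => /andP[].
apply/he_piP/andP; split; rewrite he_leUx; apply/andP; split;
  solve [apply: he_le_trans _ (L _ _); assumption
       | apply: he_le_trans _ (R _ _); assumption].
Qed.

Fact heq_le_refl : reflexive heq_le.
Proof. by move=> p; exact: he_le_refl. Qed.

Fact heq_le_anti : antisymmetric heq_le.
Proof. by move=> p q h; rewrite -[p]reprK -[q]reprK; apply/he_piP. Qed.

Fact heq_le_trans : transitive heq_le.
Proof. by move=> q p r; exact: he_le_trans. Qed.

HB.instance Definition _ := Order.Le_isPOrder.Build d He
  heq_le_refl heq_le_anti heq_le_trans.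

Fact heq_lexI (p q r : He) : (p <= heq_meet q r) = (p <= q) && (p <= r).
Proof.
rewrite -[p]reprK -[q]reprK -[r]reprK heq_meet_pi.
by rewrite /Order.le /= !heq_le_pi he_lexI.
Qed.

Fact heq_leUx (p q r : He) : (heq_join p q <= r) = (p <= r) && (q <= r).
Proof.
rewrite -[p]reprK -[q]reprK -[r]reprK heq_join_pi.
by rewrite /Order.le /= !heq_le_pi he_leUx.
Qed.

HB.instance Definition _ := Order.POrder_isMeetSemilattice.Build d He heq_lexI.
HB.instance Definition _ := Order.POrder_isJoinSemilattice.Build d He heq_leUx.

Fact heq_meetUl : left_distributive (@Order.meet _ He) Order.join.
Proof.
move=> p q r; rewrite -[p]reprK -[q]reprK -[r]reprK.
set a := repr p; set b := repr q; set c := repr r.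
change (heq_meet (heq_join (\pi_He a) (\pi_He b)) (\pi_He c) =
  heq_join (heq_meet (\pi_He a) (\pi_He c)) (heq_meet (\pi_He b) (\pi_He c))).
by rewrite heq_join_pi !heq_meet_pi heq_join_pi meetUl.
Qed.

HB.instance Definition _ := Order.Lattice_Meet_isDistrLattice.Build d He heq_meetUl.

Fact heq_le0x (p : He) : \pi_He \bot <= p.
Proof.
rewrite -[p]reprK /Order.le /= heq_le_pi; apply/he_leP => x.
by rewrite join0x => ->; rewrite joinx1.
Qed.

Fact heq_lex1 (p : He) : p <= \pi_He \top.
Proof.
by rewrite -[p]reprK /Order.le /= heq_le_pi; apply/he_leP => x _; rewrite join1x.
Qed.

HB.instance Definition _ := Order.hasBottom.Build d He heq_le0x.
HB.instance Definition _ := Order.hasTop.Build d He heq_lex1.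

Lemma he_le_pi a b : (\pi_He a <= \pi_He b) = he_le a b.
Proof. exact: heq_le_pi. Qed.

Lemma he_meet_pi a b :
  Order.meet (\pi_He a) (\pi_He b) = \pi_He (Order.meet a b).
Proof. exact: heq_meet_pi. Qed.

Lemma he_join_pi a b :
  Order.join (\pi_He a) (\pi_He b) = \pi_He (Order.join a b).
Proof. exact: heq_join_pi. Qed.

End HeitmannLattice.

Definition Heit (A : comPzRingType) := He (Zar A).
HB.instance Definition _ A := Order.TBDistrLattice.on (Heit A).
HB.instance Definition _ A := EqQuotient.on (Heit A).

Record jacIdeal (A : comPzRingType) := MkJacIdeal {
  jacideal_set :> set A;
  _ : `[< exists n (x : 'I_n -> A), jacideal_set = jac (idgen x) >]
}.

HB.instance Definition _ A := [isSub for @jacideal_set A].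
HB.instance Definition _ A := [Choice of jacIdeal A by <:].

Fact jacI_subproof (A : comPzRingType) (j : fgIdeal A) :
  `[< exists n (x : 'I_n -> A), jac j = jac (idgen x) >].
Proof. by apply/asboolP; have [n [x ->]] := fgideal_fg j; exists n, x. Qed.

Definition jacI (A : comPzRingType) (j : fgIdeal A) : jacIdeal A :=
  MkJacIdeal (jacI_subproof j).

(* Main.v *)
Require Import Defs.
From mathcomp Require Import all_boot all_order all_algebra.
From mathcomp Require Import generic_quotient boolp classical_sets.
From mathcomp Require Import ring.

(** The Heitmann preorder on a lattice only looks at which joins equal 1.  In
    the Zariski lattice, the join of [zarD a] and [zarD c] is 1 exactly when
    [a] and [c] are comaximal ([zarU_eq1]), so [zarD a] precedes [zarD b] when
    every finitely generated ideal comaximal with [a] is comaximal with [b].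
    It is enough to test the principal ideals generated by the [1 + x * y] with
    [x] in [a], since a comaximality relation [x + z = 1] has [z = 1 + x * -1];
    and such a principal ideal is comaximal with [b] when its generator is
    invertible modulo [b].  The preorder is therefore the inclusion of [a] in
    [jac b] ([he_le_zarD_sub_jac]).

    As [jac] is a closure operator on ideals, this is also the inclusion of
    [jac a] in [jac b] ([he_le_zarD]), and the first claim follows by
    antisymmetry ([pi_zarD_eq]).  Since every class of the Heitmann lattice is
    that of some [zarD j], and every [jacIdeal] is some [jacI j], the first
    claim makes the correspondence between the two a bijection.  The operations
    on the [jacIdeal]s are transported along it, and their formulas come from
    those of the Zariski lattice, which the quotient map preserves. *)

Import Order.TTheory GRing.Theory.
Local Open Scope classical_set_scope.
Local Open Scope ring_scope.
Local Open Scope quotient_scope.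

Section JacobsonClosure.
Set Implicit Arguments.
Unset Strict Implicit.
Context {A : comPzRingType}.
Implicit Types (I J : set A).

Lemma sub_jac I : is_ideal I -> I `<=` jac I.
Proof.
move=> hI x Ix y; exists 1.
rewrite mulr1 addrAC subrr add0r; exact: Defs.idealMr.
Qed.

(** If [z] inverts [1 + x * y] modulo [I], then [(1 + x * y) * z] is 1 plus an
    element of [jac J], hence invertible modulo [J], and so is [1 + x * y]. *)
Lemma jac_min I J : I `<=` jac J -> jac I `<=` jac J.
Proof.
move=> IJ x Ix y; have [z /IJ /(_ 1)[w hw]] := Ix y.
exists (z * w); move: hw; congr (J _); ring.
Qed.

Lemma sub_jac_iff I J : is_ideal I -> I `<=` jac J <-> jac I `<=` jac J.
Proof.
move=> hI; split; first exact: jac_min.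
by move=> IJ x /(sub_jac hI) /IJ.
Qed.

End JacobsonClosure.

Section HeitmannOfRing.
Set Implicit Arguments.
Unset Strict Implicit.
Context {A : comPzRingType}.
Implicit Types (a b c j : fgIdeal A).

(** A radical contains 1 exactly when the ideal itself does, powers of 1 being
    1. *)
Lemma zarU_eq1 a c :
  (zarD a `|` zarD c)%O = \top%O <->
  exists x z, [/\ (a : set A) x, (c : set A) z & x + z = 1].
Proof.
rewrite zarU; split.
- move=> h; have : zar_set (zarD (fgadd a c)) 1.
    by rewrite h; apply: sub_nilrad; exact: (idgen_gen _ ord0).
  by case=> k; rewrite expr1n => -[x ax [z cz xz]]; exists x, z.
- case=> x [z [ax cz xz1]]; apply/eqP; rewrite -le1x; apply/asboolP.
  apply: nilradS; apply: idgen_min => [|_]; first exact: fgideal_ideal.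
  by exists x => //; exists z.
Qed.

(** If [zarD a] precedes [zarD b], then [1 + x * y], which generates an ideal
    comaximal with [a], generates one comaximal with [b], and the coefficient of
    [1 + x * y] in that relation is its inverse modulo [b].  Conversely, in a
    relation [x + z = 1] between [a] and [c], the element [z] is invertible
    modulo [b], which gives a relation between [b] and [c]. *)
Lemma he_le_zarD_sub_jac a b :
  he_le (zarD a) (zarD b) <-> (a : set A) `<=` jac b.
Proof.
split=> [/he_leP hab x ax y|ab].
- pose c := fggen (fun _ : 'I_1 => 1 + x * y).
  have : (zarD b `|` zarD c)%O = \top%O.
    apply/hab/zarU_eq1; exists (- (x * y)), (1 + x * y); split.
    + apply: idealN; first exact: fgideal_ideal.
      by apply: Defs.idealMr => //; exact: fgideal_ideal.
    + exact: (idgen_gen _ ord0).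
    + by rewrite addrC addrK.
  case/zarU_eq1 => u [_ [bu [k ->]]]; rewrite big_ord1 => uk1.
  exists (k ord0).
  have -> : (1 + x * y) * k ord0 - 1 = - u by rewrite -[X in _ - X]uk1; ring.
  by apply: idealN => //; exact: fgideal_ideal.
- apply/he_leP => s; have [c ->] := zarP s.
  case/zarU_eq1 => x [z [/ab /(_ (-1))[w bw] cz xz1]].
  apply/zarU_eq1; exists (1 - z * w), (z * w); split.
  + have zE : z = 1 + x * -1 by rewrite mulrN1 -xz1 addrAC subrr add0r.
    have -> : 1 - z * w = - ((1 + x * -1) * w - 1) by rewrite zE; ring.
    by apply: idealN => //; exact: fgideal_ideal.
  + by apply: Defs.idealMr => //; exact: fgideal_ideal.
  + by rewrite subrK.
Qed.

Lemma he_le_zarD a b : he_le (zarD a) (zarD b) <-> jac a `<=` jac b.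
Proof. by rewrite he_le_zarD_sub_jac; apply: sub_jac_iff; exact: fgideal_ideal. Qed.

Lemma pi_zarD_eq a b :
  \pi_(Heit A) (zarD a) = \pi_(Heit A) (zarD b) <-> jac a = jac b :> set A.
Proof.
apply: iff_trans (he_piP _ _) _; split.
- by case/andP => /he_le_zarD ab /he_le_zarD ba; apply/seteqP.
- by move=> e; apply/andP; split; apply/he_le_zarD; rewrite e.
Qed.

Lemma heitP (p : Heit A) : exists j, \pi_(Heit A) (zarD j) = p.
Proof. by have [j e] := zarP (repr p); exists j; rewrite -e reprK. Qed.

Lemma jacIdealP (J : jacIdeal A) : exists j, jacI j = J.
Proof.
case: J => S hS; have /asboolP[n [x Sx]] := hS.
by exists (fggen x); apply: val_inj.
Qed.

Definition heit_jac (p : Heit A) : jacIdeal A := jacI (sval (cid (heitP p))).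

Definition jac_heit (J : jacIdeal A) : Heit A :=
  \pi_(Heit A) (zarD (sval (cid (jacIdealP J)))).

Lemma heit_jacE j : heit_jac (\pi_(Heit A) (zarD j)) = jacI j.
Proof.
by rewrite /heit_jac; case: cid => i /= /pi_zarD_eq e; apply: val_inj.
Qed.

Lemma jac_heitE j : jac_heit (jacI j) = \pi_(Heit A) (zarD j).
Proof.
rewrite /jac_heit; case: cid => i /= e.
by apply/pi_zarD_eq; exact: (congr1 (@jacideal_set A) e).
Qed.

Lemma heit_jacK : cancel heit_jac jac_heit.
Proof. by move=> p; have [j <-] := heitP p; rewrite heit_jacE jac_heitE. Qed.

Lemma jac_heitK : cancel jac_heit heit_jac.
Proof. by move=> J; have [j <-] := jacIdealP J; rewrite jac_heitE heit_jacE. Qed.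

End HeitmannOfRing.

Theorem corollary4p3p3 (A : comPzRingType) :
  (forall j1 j2 : fgIdeal A,
     \pi_(Heit A) (zarD j1) = \pi_(Heit A) (zarD j2)
     <-> jac j1 = jac j2 :> set A) /\
  exists (jmeet jjoin : jacIdeal A -> jacIdeal A -> jacIdeal A)
         (phi : Heit A -> jacIdeal A),
    [/\ (forall j : fgIdeal A, phi (\pi_(Heit A) (zarD j)) = jacI j)
          /\ bijective phi,
        {morph phi : p q / Order.meet p q >-> jmeet p q},
        {morph phi : p q / Order.join p q >-> jjoin p q},
        forall j1 j2 : fgIdeal A,
          jmeet (jacI j1) (jacI j2) = jacI (fgmul j1 j2) &
        forall j1 j2 : fgIdeal A,
          jjoin (jacI j1) (jacI j2) = jacI (fgadd j1 j2)].
Proof.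
split; first exact: pi_zarD_eq.
exists (fun J K => heit_jac (Order.meet (jac_heit J) (jac_heit K))).
exists (fun J K => heit_jac (Order.join (jac_heit J) (jac_heit K))).
exists heit_jac; split.
- split; first exact: heit_jacE.
  by exists jac_heit; [exact: heit_jacK|exact: jac_heitK].
- by move=> p q; rewrite !heit_jacK.
- by move=> p q; rewrite !heit_jacK.
- move=> a b; rewrite !jac_heitE -heit_jacE -zarI.
  by congr heit_jac; exact: he_meet_pi.
- move=> a b; rewrite !jac_heitE -heit_jacE -zarU.
  by congr heit_jac; exact: he_join_pi.
Qed.
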